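(* Let $\mathcal{V}\subset \mathbb{R}^2$ be a weakly bialgebraic subset (for the map $E$ defined in the context) which is not a singleton. Then either $\mathcal{V}=L_t=\{(x,t) : x\in\mathbb{R}\}$ for some $t\in\mathbb{R}$, or $\mathcal{V}=S_t=\{(t,y): y\in\mathbb{R}\}$ for some $t\in\mathbb{R}$.
   Context: Let $G=\mathrm{Res}_{\mathbb{C}/\mathbb{R}}\mathbf{G}_{m,\mathbb{C}}=\mathrm{Spec}\,\mathbb{R}[X,Y][\frac{1}{X^2+Y^2}]$, so $G(\mathbb{R})=\mathbb{R}^2\setminus\{0\}$. Identify $\mathbb{R}^2=\mathbf{A}^2(\mathbb{R})$ with $\mathbb{C}$ via $(x,y)\mapsto x+iy$, and define $E:\mathbb{R}^2\to G(\mathbb{R})$ by $E(x,y)=(\mathrm{Re}\, e^{2\pi i(x+iy)},\mathrm{Im}\, e^{2\pi i(x+iy)})$. A subset $\mathcal{V}\subsetneq\mathbb{R}^2$ is called weakly bialgebraic if (1) there exist algebraic (closed) subvarieties $V\subset\mathbf{A}^2_{\mathbb{R}}$ and $W\subsetneq G$ such that $\mathcal{V}=V(\mathbb{R})$ and $E(\mathcal{V})\subset W(\mathbb{R})$; and (2) $\mathcal{V}$ cannot be written as $V_1(\mathbb{R})\cup V_2(\mathbb{R})$ with $V_1,V_2\subset\mathbf{A}^2_{\mathbb{R}}$ algebraic subvarieties such that both inclusions $V_i(\mathbb{R})\subset\mathcal{V}$ are proper.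
   Formalization: The set V is additionally assumed nonempty: the empty set satisfies the definition of weakly bialgebraic as given, is not a singleton, and is neither a line L_t nor a line S_t. *)

(* Defs.v *)
From HB Require Import structures.
From mathcomp Require Import all_boot all_order all_algebra.
From mathcomp Require Import all_classical all_reals all_analysis.
From mathcomp Require Import complex.

Set Implicit Arguments.
Unset Strict Implicit.
Unset Printing Implicit Defensive.

Import Order.TTheory GRing.Theory Num.Theory.

Local Open Scope classical_set_scope.
Local Open Scope ring_scope.

(* [radical_ideal O I]: I is a radical ideal of the subring O of A. Taking a
   subring of an ambient ring lets the localization R[X,Y][1/(X^2+Y^2)] be
   handled inside the fraction field of R[X,Y]. *)
Definition radical_ideal (A : comNzRingType) (O I : set A) : Prop :=
  [/\ I `<=` O,
      I 0,
      (forall f g, I f -> I g -> I (f + g)),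
      (forall f g, O f -> I g -> I (f * g)) &
      (forall f n, O f -> I (f ^+ n) -> I f)].

Section WeaklyBialgebraic.
Variable R : realType.

(* R[X,Y] is encoded as {poly {poly R}} = R[X][Y]: the outer indeterminate is
   Y. *)
Definition eval2 (p : {poly {poly R}}) (a : R * R) : R := p.[a.2%:P].[a.1].

(* The polynomial X^2 + Y^2. *)
Definition normXY : {poly {poly R}} := ('X ^+ 2)%:P + 'X ^+ 2.

(* Closed subvarieties of Spec R[X,Y], given by their radical ideals. *)
Record A2_subvariety := A2Subvariety {
  A2_ideal : set {poly {poly R}};
  A2_idealP : radical_ideal setT A2_ideal }.

Definition A2_points (V : A2_subvariety) : set (R * R) :=
  [set a | forall p, A2_ideal V p -> eval2 p a = 0].

(* p / (X^2 + Y^2)^n in R(X,Y). *)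
Definition G_frac (p : {poly {poly R}}) (n : nat) :
    {fraction {poly {poly R}}} :=
  tofrac p / tofrac normXY ^+ n.

(* The coordinate ring R[X,Y][1/(X^2+Y^2)] of G, inside R(X,Y). *)
Definition G_ring : set {fraction {poly {poly R}}} :=
  [set f | exists p n, f = G_frac p n].

Record G_subvariety := GSubvariety {
  G_ideal : set {fraction {poly {poly R}}};
  G_idealP : radical_ideal G_ring G_ideal }.

(* W is strictly contained in G: the closed subvariety G itself has zero
   ideal. *)
Definition G_proper (W : G_subvariety) : Prop := G_ideal W <> [set 0].

(* W(R) inside G(R) = R^2 \ {0}. *)
Definition G_points (W : G_subvariety) : set (R * R) :=
  [set a | a <> (0, 0) /\
    forall p n, G_ideal W (G_frac p n) ->
      eval2 p a / (a.1 ^+ 2 + a.2 ^+ 2) ^+ n = 0].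

Definition cexp (z : R[i]) : R[i] :=
  ((expR (complex.Re z) * cos (complex.Im z)) +i*
   (expR (complex.Re z) * sin (complex.Im z)))%C.

Definition E (a : R * R) : R * R :=
  let w := cexp ((0 +i* (2 * pi))%C * (a.1 +i* a.2)%C) in
  (complex.Re w, complex.Im w).

(* The empty set satisfies this definition (the last condition is then vacuous);
   nonemptiness has to be assumed separately. *)
Definition weakly_bialgebraic (V : set (R * R)) : Prop :=
  [/\ V <> setT,
      (exists (V0 : A2_subvariety) (W : G_subvariety),
         [/\ V = A2_points V0, G_proper W & E @` V `<=` G_points W]) &
      ~ (exists V1 V2 : A2_subvariety,
           [/\ V = A2_points V1 `|` A2_points V2,
               A2_points V1 `<` V & A2_points V2 `<` V])].

Definition horizontal_line (t : R) : set (R * R) := [set (x, t) | x in setT].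

Definition vertical_line (t : R) : set (R * R) := [set (t, y) | y in setT].

End WeaklyBialgebraic.

(* Main.v *)
Require Import Defs.
From HB Require Import structures.
From mathcomp Require Import all_boot all_order all_algebra.
From mathcomp Require Import all_classical all_reals all_analysis.
From mathcomp Require Import complex ring lra.
From mathcomp Require polyrcf.

(** An Ax-Lindemann argument made elementary. Suppose that V is not a line, and
    let P be a polynomial of least Y-degree among the nonzero polynomials
    vanishing on V. Near a point of V where P_Y and the leading coefficient of P
    do not vanish, V is an arc, so a function vanishing on V has a vanishing
    derivative along the field D = P_Y d/dX - P_X d/dY. An algebraic relation on
    E(V) is a linear relation between exponentials of the linear forms
    h = i k x + l y. In a shortest such relation with polynomial coefficients,
    differentiating and eliminating one term yields polynomials a, b with
    b D(a) - a D(b) + a b D(h) = 0 on V for some h <> 0, that is,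
    a / b = c exp(-h) on V. But a / b is algebraic over C(h), since V is a curve
    and h is a coordinate on it, whereas exp(-h) is transcendental over C(h):
    on the relations sum_j r_j(h) a^j b^(n-j) = 0 the field D acts as
    r_j |-> r_j' - j r_j, and combining it with scalars kills all terms but one.
    That h is nonconstant on V is where the lines are excluded. *)

Set Implicit Arguments.
Unset Strict Implicit.
Unset Printing Implicit Defensive.

Import Order.TTheory GRing.Theory Num.Theory.
Import numFieldNormedType.Exports.

Local Open Scope classical_set_scope.
Local Open Scope ring_scope.

(** * Real and complex polynomial functions on the plane *)

Section Eval2.
Variable R : realType.
Implicit Types (p : {poly {poly R}}) (q : R * R).

Lemma eval2D p1 p2 q : eval2 (p1 + p2) q = eval2 p1 q + eval2 p2 q.
Proof. by rewrite /eval2 !hornerE. Qed.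

Lemma eval2N p q : eval2 (- p) q = - eval2 p q.
Proof. by rewrite /eval2 !hornerE. Qed.

Lemma eval2M p1 p2 q : eval2 (p1 * p2) q = eval2 p1 q * eval2 p2 q.
Proof. by rewrite /eval2 !hornerE. Qed.

Lemma eval2X p n q : eval2 (p ^+ n) q = eval2 p q ^+ n.
Proof. by rewrite /eval2 !horner_exp. Qed.

Lemma eval2P (c : {poly R}) q : eval2 c%:P q = c.[q.1].
Proof. by rewrite /eval2 !hornerE. Qed.

Lemma eval2Y q : eval2 'X q = q.2.
Proof. by rewrite /eval2 !hornerE. Qed.

Lemma eval2_map (p : {poly {poly R}}) x y :
  eval2 p (x, y) = (map_poly (horner^~ x) p).[y].
Proof.
rewrite /eval2 /= -[in RHS](hornerC y x) -[y%:P.[x]]/(horner_eval x y%:P).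
by rewrite -[map_poly _ p]/(map_poly (horner_eval x) p) horner_map.
Qed.

End Eval2.

(** Complex polynomial functions are handled through their values; real and imaginary parts,
    derivatives along a curve and linear changes of coordinates are obtained by induction on this
    predicate. *)
Inductive pfun (R : realType) : (R * R -> R[i]) -> Prop :=
| pfun_cst c : pfun (fun _ => c)
| pfun_x : pfun (fun q => (q.1)%:C%C)
| pfun_y : pfun (fun q => (q.2)%:C%C)
| pfunD F G : pfun F -> pfun G -> pfun (fun q => F q + G q)
| pfunM F G : pfun F -> pfun G -> pfun (fun q => F q * G q).

Section PolynomialFunctions.
Variable R : realType.
Implicit Types (F G : R * R -> R[i]).

Lemma pfunX F n : pfun F -> pfun (fun q => F q ^+ n).
Proof.
move=> pF; elim: n => [|n IH]; first by under eq_fun do rewrite expr0; constructor.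
by under eq_fun do rewrite exprS; constructor.
Qed.

Lemma pfunN F : pfun F -> pfun (fun q => - F q).
Proof.
by move=> pF; under eq_fun do rewrite -mulN1r; constructor=> //; constructor.
Qed.

Lemma pfunB F G : pfun F -> pfun G -> pfun (fun q => F q - G q).
Proof. by move=> pF pG; constructor=> //; exact: pfunN. Qed.

Lemma pfun_sum (I : Type) (s : seq I) (F : I -> R * R -> R[i]) :
  (forall i, pfun (F i)) -> pfun (fun q => \sum_(i <- s) F i q).
Proof.
move=> pF; elim: s => [|i s IH].
  by under eq_fun do rewrite big_nil; constructor.
by under eq_fun do rewrite big_cons; constructor.
Qed.

Lemma pfun_horner (r : {poly R[i]}) F : pfun F -> pfun (fun q => r.[F q]).
Proof.
move=> pF; elim/poly_ind: r => [|r c IH].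
  by under eq_fun do rewrite horner0; constructor.
under eq_fun do rewrite hornerMXaddC.
by do 2 constructor.
Qed.

Lemma pfun_horner_x (c : {poly R}) : pfun (fun q => (c.[q.1])%:C%C).
Proof.
elim/poly_ind: c => [|r c IH].
  by under eq_fun do rewrite horner0; constructor.
under eq_fun do rewrite hornerMXaddC rmorphD rmorphM.
by do 2 constructor => //; constructor.
Qed.

Lemma pfun_eval2 (p : {poly {poly R}}) : pfun (fun q => (eval2 p q)%:C%C).
Proof.
elim/poly_ind: p => [|p c IH].
  by under eq_fun do rewrite /eval2 !horner0; constructor.
under eq_fun do rewrite eval2D eval2M eval2Y eval2P rmorphD rmorphM.
by constructor; [constructor=> //; constructor|exact: pfun_horner_x].
Qed.

Lemma pfun_ReIm F : pfun F ->
  exists p1 p2, forall q, F q = (eval2 p1 q +i* eval2 p2 q)%C.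
Proof.
elim=> {F} [c| | |F G _ [p1 [p2 Fp]] _ [r1 [r2 Gr]]
           |F G _ [p1 [p2 Fp]] _ [r1 [r2 Gr]]].
- exists (complex.Re c)%:P%:P, (complex.Im c)%:P%:P => q.
  by rewrite !eval2P !hornerC; case: c.
- by exists 'X%:P, 0 => q; rewrite !eval2P !hornerE.
- by exists 'X, 0 => q; rewrite eval2Y /eval2 !hornerE.
- exists (p1 + r1), (p2 + r2) => q.
  by rewrite !eval2D Fp Gr.
- exists (p1 * r1 - p2 * r2), (p1 * r2 + p2 * r1) => q.
  by rewrite !eval2D eval2N !eval2M Fp Gr.
Qed.

End PolynomialFunctions.

(** * Irreducible real algebraic sets *)

Section Irreducible.
Variables (R : realType) (V0 : A2_subvariety R).
Let V := A2_points V0.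
Hypothesis V_irr : ~ (exists V1 V2 : A2_subvariety R,
  [/\ V = A2_points V1 `|` A2_points V2,
      A2_points V1 `<` V & A2_points V2 `<` V]).
Implicit Types (F G : R * R -> R[i]).

Lemma radical_vanishing_ideal (S : set (R * R)) :
  radical_ideal setT [set p | forall q, S q -> eval2 p q = 0].
Proof.
split=> //=.
- by move=> q _; rewrite /eval2 !horner0.
- by move=> f g If Ig q Sq; rewrite eval2D If// Ig// addr0.
- by move=> f g _ Ig q Sq; rewrite eval2M Ig// mulr0.
- move=> f n _ Ifn q Sq; have /eqP := Ifn q Sq.
  by rewrite eval2X expf_eq0 => /andP[_ /eqP].
Qed.

(** The ideal of all polynomials vanishing on the locus contains [A2_ideal V0] and the real and
    imaginary parts of [F], so it has no further real zeros. *)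
Lemma zero_locus_subvariety F : pfun F ->
  exists V1 : A2_subvariety R, A2_points V1 = [set q | V q /\ F q = 0].
Proof.
move=> /pfun_ReIm[p1 [p2 Fp]].
exists (A2Subvariety (radical_vanishing_ideal [set q | V q /\ F q = 0])).
apply/seteqP; split=> q; rewrite /A2_points /=.
  move=> Zq; split; first by move=> p Ip; apply: Zq => q' [Vq' _]; exact: Vq'.
  rewrite Fp !Zq //= => q' [_]; rewrite Fp => -[]//.
by move=> [Vq Fq] p; exact.
Qed.

(** Otherwise the zero loci of [F] and [G] in [V] would be two proper subvarieties covering [V]. *)
Lemma vanish_prime F G : pfun F -> pfun G ->
  (forall q, V q -> F q * G q = 0) ->
  (forall q, V q -> F q = 0) \/ (forall q, V q -> G q = 0).
Proof.
move=> pF pG FG0.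
have [V1 V1E] := zero_locus_subvariety pF.
have [V2 V2E] := zero_locus_subvariety pG.
apply: contrapT => /not_orP[/existsNP[q1 /not_implyP[Vq1 Fq1]]].
move=> /existsNP[q2 /not_implyP[Vq2 Gq2]].
apply: V_irr; exists V1, V2; rewrite V1E V2E; split.
- apply/seteqP; split=> q /=; last by case=> -[].
  move=> Vq; have /eqP := FG0 _ Vq; rewrite mulf_eq0 => /orP[]/eqP; first by left.
  by right.
- by split=> [q []//|] /(_ _ Vq1)[].
- by split=> [q []//|] /(_ _ Vq2)[].
Qed.

(** Over the complex numbers [r] splits into linear factors, one of which vanishes on [V] by
    [vanish_prime]; the factors cannot run out, as [V] is nonempty. *)
Lemma vanish_algebraic_const F (r : {poly R[i]}) : pfun F -> r != 0 ->
  V !=set0 -> (forall q, V q -> r.[F q] = 0) ->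
  exists c, forall q, V q -> F q = c.
Proof.
move=> pF r0 [q0 Vq0]; have [s rE] := closed_field_poly_normal r.
move: r0; rewrite -lead_coef_eq0; move: (lead_coef r) rE => l -> l0.
have {l0} rF (q : R * R) : (l *: \prod_(z <- s) ('X - z%:P)).[F q] = 0 ->
    (\prod_(z <- s) ('X - z%:P)).[F q] = 0.
  by move=> /eqP; rewrite hornerZ mulf_eq0 (negPf l0) /= => /eqP.
move=> lF; have {rF lF} : forall q, V q -> (\prod_(z <- s) ('X - z%:P)).[F q] = 0.
  by move=> q Vq; apply/rF/lF.
elim: s => [|z s IH] H.
  by have /eqP := H _ Vq0; rewrite big_nil hornerC oner_eq0.
case: (@vanish_prime (fun q => F q - z)
         (fun q => (\prod_(z <- s) ('X - z%:P)).[F q])).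
- by apply: pfunB => //; constructor.
- exact: pfun_horner.
- by move=> q /H; rewrite big_cons hornerM hornerXsubC.
- by move=> Fz; exists z => q Vq; apply/eqP; rewrite -subr_eq0 Fz.
- exact: IH.
Qed.

Hypothesis V_neq0 : V !=set0.
Hypothesis V_not_singleton : ~ (exists a, V = [set a]).

(** If a polynomial of the ideal were nonzero at a point of the line, its restriction to the line
    would be a nonzero polynomial in y vanishing on [V]. Then y would be constant on [V], making [V]
    a singleton. *)
Lemma vanish_vertical t : (forall q, V q -> q.1 = t) -> V = vertical_line t.
Proof.
move=> Vt; apply/seteqP; split=> [[x y] Vq|_ [y _ <-]].
  by exists y; rewrite // -(Vt _ Vq).
move=> p Ip; apply: contrapT => /eqP p0.
pose r := map_poly (real_complex R) (map_poly (horner^~ t) p).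
have r0 : r != 0.
  rewrite map_poly_eq0; apply: contra_neq p0 => p0.
  by rewrite eval2_map p0 horner0.
have [|q Vq|c cE] := @vanish_algebraic_const (fun q => (q.2)%:C%C) r _ r0 V_neq0.
- exact: pfun_y.
- by rewrite horner_map -eval2_map -(Vt _ Vq) -surjective_pairing Vq.
have [q0 Vq0] := V_neq0; apply: V_not_singleton; exists q0.
apply/seteqP; split=> [q Vq|_ ->//] /=.
rewrite [q]surjective_pairing [q0]surjective_pairing (Vt _ Vq) (Vt _ Vq0).
by congr (_, _); apply: (fmorph_inj (real_complex R)); rewrite /= !cE.
Qed.

Lemma vanish_horizontal t : (forall q, V q -> q.2 = t) -> V = horizontal_line t.
Proof.
move=> Vt; apply/seteqP; split=> [[x y] Vq|_ [x _ <-]].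
  by exists x; rewrite // -(Vt _ Vq).
move=> p Ip; apply: contrapT => /eqP p0.
pose r := map_poly (real_complex R) p.[t%:P].
have r0 : r != 0.
  rewrite map_poly_eq0; apply: contra_neq p0 => p0.
  by rewrite /eval2 p0 horner0.
have [|q Vq|c cE] := @vanish_algebraic_const (fun q => (q.1)%:C%C) r _ r0 V_neq0.
- exact: pfun_x.
- by rewrite horner_map -(Vt _ Vq) -/(eval2 p q) Vq.
have [q0 Vq0] := V_neq0; apply: V_not_singleton; exists q0.
apply/seteqP; split=> [q Vq|_ ->//] /=.
rewrite [q]surjective_pairing [q0]surjective_pairing (Vt _ Vq) (Vt _ Vq0).
by congr (_, _); apply: (fmorph_inj (real_complex R)); rewrite /= !cE.
Qed.

(** The exponents have this shape because E(x, y) is exp(-2 pi y) times a phase depending on x. Real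
    and imaginary parts separate the two coordinates. *)
Definition linform (K L : R) (q : R * R) : R[i] := ((L * q.2) +i* (K * q.1))%C.

Lemma pfun_linform K L : pfun (linform K L).
Proof.
have -> : linform K L =
    fun q => (0 +i* K)%C * (q.1)%:C%C + L%:C%C * (q.2)%:C%C.
  apply/funext => q; rewrite /linform.
  by congr (_ +i* _)%C => /=; ring.
by do 2 constructor; constructor.
Qed.

Lemma vanish_linform_line K L (r : {poly R[i]}) : (K, L) != (0, 0) -> r != 0 ->
  (forall q, V q -> r.[linform K L q] = 0) ->
  (exists t, V = horizontal_line t) \/ (exists t, V = vertical_line t).
Proof.
move=> KL0 r0 rV.
have [c cE] := vanish_algebraic_const (pfun_linform K L) r0 V_neq0 rV.
have [K0|K0] := eqVneq K 0.
  have L0 : L != 0 by apply: contra_neq KL0 => L0; rewrite K0 L0.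
  left; exists (complex.Re c / L); apply: vanish_horizontal => q /cE <- /=.
  by rewrite mulrC mulKf.
right; exists (complex.Im c / K); apply: vanish_vertical => q /cE <- /=.
by rewrite mulrC mulKf.
Qed.

End Irreducible.

(** * Arcs on plane curves *)

Section PartialDerivatives.
Variable R : realType.
Implicit Types (p : {poly {poly R}}).

(* The outer indeterminate is Y, so the partial derivative in Y is [p^`()]. *)
Definition pderiv p : {poly {poly R}} := map_poly (@deriv R) p.

Lemma pderivD p1 p2 : pderiv (p1 + p2) = pderiv p1 + pderiv p2.
Proof. exact: raddfD. Qed.

Lemma pderivMY p : pderiv (p * 'X) = pderiv p * 'X.
Proof.
apply/polyP => i; rewrite coef_map !coefMX.
by case: ifP => _; rewrite ?raddf0 ?coef_map.
Qed.

Lemma pderivC (c : {poly R}) : pderiv c%:P = (c^`())%:P.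
Proof. exact: map_polyC. Qed.

Lemma deriv_horner_polyC p (c : R) : (p.[c%:P])^`() = (pderiv p).[c%:P].
Proof.
elim/poly_ind: p => [|p d IH]; first by rewrite /pderiv raddf0 !horner0 raddf0.
rewrite pderivD pderivMY pderivC !hornerMXaddC derivD derivM derivC mulr0 addr0.
by rewrite IH.
Qed.

Lemma continuous_eval2 p (f : R -> R) x0 : {for x0, continuous f} ->
  {for x0, continuous (fun x => eval2 p (x, f x))}.
Proof.
move=> fc; elim/poly_ind: p => [|p c IH].
  have -> : (fun x => eval2 0 (x, f x)) = cst 0.
    by apply/funext => x; rewrite /eval2 !horner0.
  exact: cst_continuous.
have -> : (fun x => eval2 (p * 'X + c%:P) (x, f x)) =
    (fun x => eval2 p (x, f x) * f x + c.[x]).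
  by apply/funext => x; rewrite eval2D eval2M eval2Y eval2P.
apply: continuousD; last exact: continuous_horner.
exact: continuousM.
Qed.

Lemma is_derive_eval2 p (f : R -> R) (x0 d : R) : is_derive x0 1 f d ->
  is_derive x0 1 (fun x => eval2 p (x, f x))
    (eval2 (pderiv p) (x0, f x0) + eval2 p^`() (x0, f x0) * d).
Proof.
move=> fd; elim/poly_ind: p => [|p c IH].
  under eq_fun do rewrite /eval2 !horner0.
  rewrite /pderiv !raddf0 /eval2 !horner0 mul0r addr0.
  exact: is_derive_cst.
under eq_fun do rewrite eval2D eval2M eval2Y eval2P /=.
have H := is_deriveD (is_deriveM IH fd) (is_derive_poly c x0).
apply: (@is_derive_eq _ _ _ _ _ _ _ _ H); rewrite pderivD pderivMY pderivC.
rewrite derivD derivM derivX derivC addr0 mulr1 !eval2D !eval2M !eval2Y eval2P.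
by rewrite /= /GRing.scale /=; ring.
Qed.

(** [B] is the quotient of p - p(X, y0) by Y - y0, and [A] that of p(X, y0) - p(x0, y0) by X -
    x0. *)
Lemma eval2_taylor p x0 y0 : exists (A : {poly R}) (B : {poly {poly R}}),
  [/\ A.[x0] = eval2 (pderiv p) (x0, y0), eval2 B (x0, y0) = eval2 p^`() (x0, y0) &
   forall x y, eval2 p (x, y) =
     eval2 p (x0, y0) + A.[x] * (x - x0) + eval2 B (x, y) * (y - y0)].
Proof.
have /factor_theorem[B pB] : root (p - (p.[y0%:P])%:P) y0%:P.
  by rewrite /root !hornerE subrr.
have /factor_theorem[A pA] : root (p.[y0%:P] - (p.[y0%:P].[x0])%:P) x0.
  by rewrite /root !hornerE subrr.
move/eqP: pB; rewrite subr_eq => /eqP pB.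
move/eqP: pA; rewrite subr_eq => /eqP pA.
exists A, B; split.
- rewrite /eval2 /= -deriv_horner_polyC pA derivD derivM derivC derivB derivX derivC.
  by rewrite subr0 mulr1 addr0 !hornerE subrr mulr0 add0r.
- rewrite [in RHS]pB /eval2 derivD derivM derivC derivB derivX derivC /=.
  by rewrite subr0 mulr1 addr0 !hornerE subrr mulr0 add0r.
- move=> x y.
  rewrite [in LHS]pB eval2D eval2M eval2D eval2Y eval2N !eval2P pA /=.
  rewrite hornerD hornerM hornerXsubC !hornerC -[p.[_].[_]]/(eval2 p (x0, y0)).
  by ring.
Qed.

(* Along [y0 + M u] and [y0 - M u], where [u = x - x0] and [M] exceeds the slope,
   [p] takes opposite signs, so the intermediate value theorem gives a zero. *)
Lemma implicit_function p (x0 y0 : R) : eval2 p (x0, y0) = 0 ->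
  eval2 p^`() (x0, y0) != 0 ->
  exists f : R -> R, [/\ f x0 = y0,
    is_derive x0 1 f (- eval2 (pderiv p) (x0, y0) / eval2 p^`() (x0, y0)) &
    \forall x \near x0, eval2 p (x, f x) = 0].
Proof.
move=> p0 py0; have [A [B [<- B0 pE]]] := eval2_taylor p x0 y0.
move: py0; rewrite -B0 => b0.
set b := eval2 B (x0, y0) in b0 *; set a := A.[x0].
pose M : R := `|a / b| + 1.
have M0 : 0 < M by rewrite ltr_wpDl.
(* Up to the factor (x - x0)^2, this is the product of the values of [p] at the two ends y0 + M u
   and y0 - M u; it is negative at [x0] since [M] exceeds |a / b|. *)
pose s (x : R) := (A.[x] + M * eval2 B (x, y0 + M * (x - x0))) *
             (A.[x] - M * eval2 B (x, y0 - M * (x - x0))).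
have lin_cont (m : R) : {for x0, continuous (fun x : R => y0 + m * (x - x0))}.
  apply: continuousD; first exact: cst_continuous.
  apply: continuousM; first exact: cst_continuous.
  by apply: continuousB; [exact: cvg_id|exact: cst_continuous].
have s_cont : {for x0, continuous s}.
  apply: continuousM.
    apply: continuousD; first exact: continuous_horner.
    apply: continuousM; first exact: cst_continuous.
    exact: continuous_eval2.
  apply: continuousB; first exact: continuous_horner.
  apply: continuousM; first exact: cst_continuous.
  apply: continuous_eval2.
  have -> : (fun x => y0 - M * (x - x0)) = (fun x => y0 + - M * (x - x0)).
    by apply/funext => x; rewrite mulNr.
  exact: lin_cont.
have s0 : s x0 < 0.
  rewrite /s subrr mulr0 subr0 addr0 -/a -/b.
  have -> : (a + M * b) * (a - M * b) = b ^+ 2 * (`|a / b| ^+ 2 - M ^+ 2).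
    by rewrite real_normK ?num_real //; field.
  rewrite pmulr_rlt0 ?exprn_even_gt0 // subr_lt0 ltr_pXn2r ?nnegrE ?(ltW M0) //.
  by rewrite /M ltrDl.
have s_near : \forall x \near x0, s x < 0.
  have sc : s x @[x --> x0] --> s x0 by exact: s_cont.
  exact: cvgr_lt sc _ s0.
(* The zeros are chosen point by point, with [y0] as default where [s x] is not negative; the bound
   on |y - y0| alone makes [f] continuous at [x0]. *)
have /choice[f fE] : forall x, exists y, `|y - y0| <= M * `|x - x0| /\
    (s x < 0 -> eval2 p (x, y) = 0).
  move=> x; have [sx|_] := boolP (s x < 0); last first.
    by exists y0; rewrite subrr normr0 mulr_ge0 // ltW.
  pose q := map_poly (horner^~ x) p.
  have qE y : q.[y] = eval2 p (x, y) by rewrite eval2_map.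
  have q_sign : q.[y0 - M * `|x - x0|] * q.[y0 + M * `|x - x0|] <= 0.
    suff -> : q.[y0 - M * `|x - x0|] * q.[y0 + M * `|x - x0|] =
        (x - x0) ^+ 2 * s x.
      by apply: mulr_ge0_le0; [exact: sqr_ge0|exact: ltW].
    have signE (a1 b1 b2 u : R) : (0 + a1 * u + b1 * (y0 - M * u - y0)) *
        (0 + a1 * u + b2 * (y0 + M * u - y0)) =
        u ^+ 2 * ((a1 + M * b2) * (a1 - M * b1)) by ring.
    rewrite !qE (pE x (y0 - _)) (pE x (y0 + _)) p0 /s; case: ger0P => _; first exact: signE.
    by rewrite !mulrN opprK [LHS]mulrC signE.
  have M1 : 0 <= M * `|x - x0| by rewrite mulr_ge0 // ltW.
  have [|y yI /rootP qy] := polyrcf.poly_ivt _ q_sign; first by lra.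
  exists y; split=> [|_]; last by rewrite -qE.
  by move: yI; rewrite in_itv /= ler_norml => /andP[? ?]; apply/andP; split; lra.
have fx0 : f x0 = y0.
  have [+ _] := fE x0; rewrite subrr normr0 mulr0 normr_le0 subr_eq0.
  by move=> /eqP.
have f_cont : {for x0, continuous f}.
  apply/cvgrPdist_le => e e0; rewrite fx0.
  have : \forall x \near x0, `|x0 - x| <= e / M.
    have idc : x @[x --> x0] --> x0 by exact: cvg_id.
    exact: cvgr_dist_le idc _ (divr_gt0 e0 M0).
  apply: filterS => x xe; rewrite distrC (le_trans (fE x).1) //.
  by rewrite mulrC -ler_pdivlMr // distrC.
(* Solving the expansion of [p] for f(x) - y0 gives f(x) = y0 + g(x) (x - x0) near [x0], which is
   differentiability in Caratheodory's form. *)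
pose g x := - A.[x] / eval2 B (x, f x).
have g_cont : {for x0, continuous g}.
  apply: continuousM; first by apply: continuousN; exact: continuous_horner.
  by apply: continuousV; [rewrite fx0|exact: continuous_eval2].
have B_near : \forall x \near x0, eval2 B (x, f x) != 0.
  have Bc : eval2 B (x, f x) @[x --> x0] --> eval2 B (x0, f x0).
    exact: continuous_eval2.
  by apply: (cvgr_neq0 _ Bc); rewrite fx0.
exists f; split=> //; last by apply: filterS s_near => x; exact: (fE x).2.
apply: (@near_eq_is_derive _ _ _ (fun x => y0 + g x * (x - x0))).
  apply: filterS2 s_near B_near => x sx Bx.
  have := (fE x).2 sx; rewrite pE p0 add0r => /eqP.
  rewrite addr_eq0 => /eqP AB; rewrite /g.
  by rewrite mulrAC mulNr AB opprK mulrAC mulfV // mul1r addrC subrK.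
apply/is_derive1_caratheodory; exists g; split=> //.
- by move=> z; rewrite subrr mulr0 addr0 addrAC subrr add0r.
- by rewrite /g fx0.
Qed.

End PartialDerivatives.

(** * Derivatives along a curve *)

Definition cderive (R : realType) (f : R -> R[i]) (x : R) (d : R[i]) : Prop :=
  is_derive x 1 (fun t => complex.Re (f t)) (complex.Re d) /\
  is_derive x 1 (fun t => complex.Im (f t)) (complex.Im d).

Section ComplexDerivative.
Variable R : realType.
Implicit Types (f g : R -> R[i]) (x : R) (d e : R[i]).

Lemma cderive_eq f x d e : cderive f x d -> d = e -> cderive f x e.
Proof. by move=> ? <-. Qed.

Lemma cderive_cst c x : cderive (fun=> c) x 0.
Proof. by split; exact: is_derive_cst. Qed.

Lemma ReD (z w : R[i]) : complex.Re (z + w) = complex.Re z + complex.Re w.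
Proof. by case: z w => [a b] [c d]. Qed.

Lemma ImD (z w : R[i]) : complex.Im (z + w) = complex.Im z + complex.Im w.
Proof. by case: z w => [a b] [c d]. Qed.

Lemma ReM (z w : R[i]) : complex.Re (z * w) =
  complex.Re z * complex.Re w - complex.Im z * complex.Im w.
Proof. by case: z w => [a b] [c d]. Qed.

Lemma ImM (z w : R[i]) : complex.Im (z * w) =
  complex.Re z * complex.Im w + complex.Im z * complex.Re w.
Proof. by case: z w => [a b] [c d]. Qed.

Lemma cderiveD f g x d e : cderive f x d -> cderive g x e ->
  cderive (fun t => f t + g t) x (d + e).
Proof.
move=> [fr fi] [gr gi]; split.
  have -> : (fun t => complex.Re (f t + g t)) =
    (fun t => complex.Re (f t)) + (fun t => complex.Re (g t)).
    by apply/funext => t; rewrite ReD.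
  by rewrite ReD; exact: is_deriveD.
have -> : (fun t => complex.Im (f t + g t)) =
    (fun t => complex.Im (f t)) + (fun t => complex.Im (g t)).
  by apply/funext => t; rewrite ImD.
by rewrite ImD; exact: is_deriveD.
Qed.

Lemma cderiveM f g x d e : cderive f x d -> cderive g x e ->
  cderive (fun t => f t * g t) x (f x * e + d * g x).
Proof.
move=> [fr fi] [gr gi]; split.
  have -> : (fun t => complex.Re (f t * g t)) =
    (fun t => complex.Re (f t)) * (fun t => complex.Re (g t)) -
    (fun t => complex.Im (f t)) * (fun t => complex.Im (g t)).
    by apply/funext => t; rewrite ReM.
  have H := is_deriveB (is_deriveM fr gr) (is_deriveM fi gi).
  apply: (@is_derive_eq _ _ _ _ _ _ _ _ H).
  by rewrite ReD !ReM /GRing.scale /=; ring.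
have -> : (fun t => complex.Im (f t * g t)) =
    (fun t => complex.Re (f t)) * (fun t => complex.Im (g t)) +
    (fun t => complex.Im (f t)) * (fun t => complex.Re (g t)).
  by apply/funext => t; rewrite ImM.
have H := is_deriveD (is_deriveM fr gi) (is_deriveM fi gr).
apply: (@is_derive_eq _ _ _ _ _ _ _ _ H).
by rewrite ImD !ImM /GRing.scale /=; ring.
Qed.

Lemma cderive_cexp f x d : cderive f x d ->
  cderive (fun t => cexp (f t)) x (cexp (f x) * d).
Proof.
move=> [fr fi].
have er := is_derive1_comp (is_derive_expR (complex.Re (f x))) fr.
have ec := is_derive1_comp (is_derive_cos (complex.Im (f x))) fi.
have es := is_derive1_comp (is_derive_sin (complex.Im (f x))) fi.
split.
  have H := is_deriveM er ec.
  apply: (@is_derive_eq _ _ _ _ _ _ _ _ H).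
  by rewrite ReM /cexp /= /GRing.scale /=; ring.
have H := is_deriveM er es.
apply: (@is_derive_eq _ _ _ _ _ _ _ _ H).
by rewrite ImM /cexp /= /GRing.scale /=; ring.
Qed.

Lemma cderive_near0 f x d : (\forall t \near x, f t = 0) -> cderive f x d ->
  d = 0.
Proof.
move=> f0 [fr fi].
have [_ dr] : is_derive x 1 (cst (0 : R)) (complex.Re d).
  apply: near_eq_is_derive fr; apply: filterS f0 => t ->; by [].
have [_ di] : is_derive x 1 (cst (0 : R)) (complex.Im d).
  apply: near_eq_is_derive fi; apply: filterS f0 => t ->; by [].
by case: d dr di {fr fi} => a b /=; rewrite !derive_cst => <- <-.
Qed.

Lemma Re_divC (z : R[i]) (c : R) : complex.Re (z / c%:C%C) = complex.Re z / c.
Proof. by rewrite -fmorphV ReM /= mulr0 subr0. Qed.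

Lemma Im_divC (z : R[i]) (c : R) : complex.Im (z / c%:C%C) = complex.Im z / c.
Proof. by rewrite -fmorphV ImM /= mulr0 add0r. Qed.

End ComplexDerivative.

Lemma cexp_add (R : realType) (z w : R[i]) : cexp (z + w) = cexp z * cexp w.
Proof.
case: z w => [a b] [c d]; apply/eqP; rewrite eq_complex /cexp /=.
by rewrite expRD cosD sinD; apply/andP; split; apply/eqP; ring.
Qed.

Lemma cexp0 (R : realType) : cexp (0 : R[i]) = 1.
Proof. by rewrite /cexp /= expR0 cos0 sin0 mulr1 mulr0. Qed.

Lemma cexp_neq0 (R : realType) (z : R[i]) : cexp z != 0.
Proof.
have : cexp z * cexp (- z) = 1 by rewrite -cexp_add subrr cexp0.
by apply: contra_eq_neq => ->; rewrite mul0r eq_sym oner_neq0.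
Qed.

(* The vector field [P_Y d/dX - P_X d/dY] is tangent to the curve [P = 0].
   [along P U F G] says that it sends [F] to [G] on [U]; as [F] is only known
   through its values, the derivative is taken along an arbitrary arc [f]. *)
Definition along (R : realType) (P : {poly {poly R}}) (U : set (R * R))
    (F G : R * R -> R[i]) : Prop :=
  forall q, U q -> forall f : R -> R, f q.1 = q.2 ->
    is_derive q.1 1 f (- eval2 (pderiv P) q / eval2 P^`() q) ->
    cderive (fun x => F (x, f x)) q.1 (G q / (eval2 P^`() q)%:C%C).

Section Along.
Variables (R : realType) (P : {poly {poly R}}) (U : set (R * R)).
Hypothesis U_reg : forall q, U q -> eval2 P^`() q != 0.
Hypothesis U_arc : forall q, U q -> exists f : R -> R, [/\ f q.1 = q.2,
    is_derive q.1 1 f (- eval2 (pderiv P) q / eval2 P^`() q) &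
    \forall x \near q.1, U (x, f x)].
Implicit Types (F G : R * R -> R[i]).
Local Notation along := (along P U).

Lemma along_eq F G G' : along F G -> (forall q, U q -> G q = G' q) -> along F G'.
Proof. by move=> FG GG' q Uq f f1 f2; rewrite -GG' //; exact: FG. Qed.

(** The arc stays in [U] near [q], so [F] vanishes along it there, and the derivative is [G q]
    divided by a nonzero number. *)
Lemma along_zero F G : along F G -> (forall q, U q -> F q = 0) ->
  forall q, U q -> G q = 0.
Proof.
move=> FG F0 q Uq; have [f [fq fd fU]] := U_arc Uq.
have /cderive_near0 := FG q Uq f fq fd.
have fF : \forall t \near q.1, F (t, f t) = 0 by apply: filterS fU => t /F0.
move=> /(_ fF)/eqP; rewrite mulf_eq0 invr_eq0 => /orP[/eqP//|].
by rewrite fmorph_eq0 (negPf (U_reg Uq)).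
Qed.

Lemma along_cst c : along (fun=> c) (fun=> 0).
Proof. by move=> q Uq f _ _; rewrite mul0r; exact: cderive_cst. Qed.

Lemma alongD F F' G G' : along F F' -> along G G' ->
  along (fun q => F q + G q) (fun q => F' q + G' q).
Proof.
move=> FF GG q Uq f f1 f2; rewrite mulrDl.
by apply: cderiveD; [exact: FF|exact: GG].
Qed.

Lemma alongM F F' G G' : along F F' -> along G G' ->
  along (fun q => F q * G q) (fun q => F q * G' q + F' q * G q).
Proof.
move=> FF GG q Uq f f1 f2.
apply: cderive_eq (cderiveM (FF _ Uq f f1 f2) (GG _ Uq f f1 f2)) _.
by rewrite f1 -surjective_pairing; ring.
Qed.

Lemma along_sum (I : Type) (s : seq I) (F G : I -> R * R -> R[i]) :
  (forall i, along (F i) (G i)) ->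
  along (fun q => \sum_(i <- s) F i q) (fun q => \sum_(i <- s) G i q).
Proof.
move=> FG; elim: s => [|i s IH].
  under eq_fun do rewrite big_nil.
  by apply: along_eq (along_cst 0) _ => q _; rewrite big_nil.
under eq_fun do rewrite big_cons.
by apply: along_eq (alongD (FG i) IH) _ => q _; rewrite big_cons.
Qed.

Lemma along_horner (r : {poly R[i]}) F F' : along F F' ->
  along (fun q => r.[F q]) (fun q => r^`().[F q] * F' q).
Proof.
move=> FF; elim/poly_ind: r => [|r c IH].
  under eq_fun do rewrite horner0.
  by apply: along_eq (along_cst 0) _ => q _; rewrite deriv0 horner0 mul0r.
under eq_fun do rewrite hornerMXaddC.
apply: along_eq (alongD (alongM IH FF) (along_cst c)) _ => q _.
by rewrite derivD derivC derivM derivX !hornerE; ring.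
Qed.

Lemma along_exp n F F' : along F F' ->
  along (fun q => F q ^+ n) (fun q => F q ^+ n.-1 *+ n * F' q).
Proof.
move=> /(along_horner 'X^n); under eq_fun do rewrite hornerXn.
by move=> /along_eq; apply => q _; rewrite derivXn hornerMn hornerXn.
Qed.

(** On an arc of slope -P_X / P_Y the derivative of [p] is p_X - p_Y P_X / P_Y; the denominator in
    [along] keeps the numerator polynomial. *)
Lemma along_eval2 p : along (fun q => (eval2 p q)%:C%C)
  (fun q => (eval2 P^`() q * eval2 (pderiv p) q -
             eval2 (pderiv P) q * eval2 p^`() q)%:C%C).
Proof.
move=> q Uq f f1 f2; split; last by rewrite Im_divC mul0r; exact: is_derive_cst.
rewrite Re_divC /=.
have H := is_derive_eval2 p f2.
apply: (@is_derive_eq _ _ _ _ _ _ _ _ H).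
rewrite f1 -surjective_pairing; have := U_reg Uq.
by move: (eval2 _ _) (eval2 _ _) (eval2 _ _) (eval2 _ _) => a b c d ?; field.
Qed.

Lemma pfun_tangent p : pfun (fun q => (eval2 P^`() q * eval2 (pderiv p) q -
  eval2 (pderiv P) q * eval2 p^`() q)%:C%C).
Proof. by under eq_fun do rewrite -!eval2M -eval2N -eval2D; exact: pfun_eval2. Qed.

Lemma along_linform K L : along (linform K L) (fun q =>
  ((- (L * eval2 (pderiv P) q)) +i* (K * eval2 P^`() q))%C).
Proof.
move=> q Uq f f1 f2; split; rewrite ?Re_divC ?Im_divC /=.
  have H := is_deriveM (is_derive_cst L q.1 1) f2.
  apply: (@is_derive_eq _ _ _ _ _ _ _ _ H).
  by rewrite scaler0 addr0 /GRing.scale /= mulNr mulrN mulrA mulNr.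
have H := is_deriveM (is_derive_cst K q.1 1) (is_derive_id q.1 1).
apply: (@is_derive_eq _ _ _ _ _ _ _ _ H).
by rewrite scaler0 addr0 /GRing.scale /= mulr1 mulfK // U_reg.
Qed.

Lemma along_cexp F F' : along F F' ->
  along (fun q => cexp (F q)) (fun q => cexp (F q) * F' q).
Proof.
move=> FF q Uq f f1 f2; have := cderive_cexp (FF q Uq f f1 f2).
by rewrite f1 -surjective_pairing mulrA.
Qed.

Lemma along_pfun F : pfun F -> exists2 G, pfun G & along F G.
Proof.
elim=> {F} [c| | |F G pF [F' pF' FF] pG [G' pG' GG]|F G pF [F' pF' FF] pG [G' pG' GG]].
- by exists (fun=> 0); [constructor|exact: along_cst].
- have := along_eval2 'X%:P; under eq_fun do rewrite eval2P hornerX.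
  by move=> H; exact: ex_intro2 (pfun_tangent 'X%:P) H.
- have := along_eval2 'X; under eq_fun do rewrite eval2Y.
  by move=> H; exact: ex_intro2 (pfun_tangent 'X) H.
- by exists (fun q => F' q + G' q); [constructor|exact: alongD].
- exists (fun q => F q * G' q + F' q * G q); last exact: alongM.
  by constructor; constructor.
Qed.

End Along.

(** * Exponentials of linear forms on a curve *)

(** The size bound makes the last column of the square coefficient matrix zero, so the determinant
    vanishes and there is a left kernel vector over [A] itself. *)
Lemma poly_dependent (A : idomainType) n (f : nat -> {poly A}) :
  (forall j, (size (f j) <= n)%N) ->
  exists2 c : 'rV[A]_n.+1, c != 0 & \sum_(j < n.+1) c 0 j *: f j = 0.
Proof.
move=> fn; pose M : 'M[A]_n.+1 := \matrix_(j, i) (f j)`_i.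
have /det0P[c c0 cM] : \det M == 0.
  rewrite (expand_det_col M ord_max) big1 // => j _.
  by rewrite mxE nth_default ?mul0r.
exists c => //; apply/polyP => i; rewrite coef0 coef_sum.
have [i_lt|i_ge] := ltnP i n.+1; last first.
  rewrite big1 // => j _; rewrite coefZ nth_default ?mulr0 //.
  by rewrite (leq_trans (fn j)) // ltnW.
move/matrixP: cM => /(_ 0 (Ordinal i_lt)); rewrite !mxE => cM; rewrite -[RHS]cM.
by apply: eq_bigr => j _; rewrite coefZ !mxE.
Qed.

Lemma linform_solve (R : realType) (K L : R) (q : R * R) : (K, L) != (0, 0) ->
  let N := ((K ^+ 2 + L ^+ 2)^-1)%:C%C in
  (q.1)%:C%C = (0 +i* - 1)%C * N * (K%:C%C * linform K L q - L%:C%C * linform (- L) K q) /\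
  (q.2)%:C%C = N * (L%:C%C * linform K L q + K%:C%C * linform (- L) K q).
Proof.
move=> KL0 /=; have N0 : K ^+ 2 + L ^+ 2 != 0.
  apply: contra_neq KL0 => /eqP.
  by rewrite paddr_eq0 ?sqr_ge0 // !sqrf_eq0 => /andP[/eqP -> /eqP ->].
by split; apply/eqP; rewrite eq_complex /=; apply/andP; split; apply/eqP; field.
Qed.

(** In [f] the inner indeterminate stands for [linform K L], over which dependence is sought later,
    and the outer one for [linform (- L) K]. *)
Lemma pfun_linform_coord (R : realType) (K L : R) F : (K, L) != (0, 0) -> pfun F ->
  exists f : {poly {poly R[i]}}, forall q,
    F q = f.[(linform (- L) K q)%:P].[linform K L q].
Proof.
move=> KL0; elim=> {F} [c| | |F G _ [f Ff] _ [g Gg]|F G _ [f Ff] _ [g Gg]].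
- by exists c%:P%:P => q; rewrite !hornerC.
- exists (((0 +i* - 1)%C * ((K ^+ 2 + L ^+ 2)^-1)%:C%C)%:P%:P *
    ((K%:C%C)%:P%:P * 'X%:P - (L%:C%C)%:P%:P * 'X)) => q.
  by rewrite !hornerE; exact: (linform_solve q KL0).1.
- exists ((((K ^+ 2 + L ^+ 2)^-1)%:C%C)%:P%:P *
    ((L%:C%C)%:P%:P * 'X%:P + (K%:C%C)%:P%:P * 'X)) => q.
  by rewrite !hornerE; exact: (linform_solve q KL0).2.
- by exists (f + g) => q; rewrite !hornerE Ff Gg.
- by exists (f * g) => q; rewrite !hornerE Ff Gg.
Qed.

(* A plane curve has transcendence degree one. *)
Lemma pfun_dependent (R : realType) (U : set (R * R)) (K L : R) F0 q0 :
  (K, L) != (0, 0) -> pfun F0 -> (forall q, U q -> F0 q = 0) -> F0 q0 != 0 ->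
  exists n, forall G : nat -> R * R -> R[i], (forall j, pfun (G j)) ->
  exists r : nat -> {poly R[i]}, (exists2 j, (j < n.+1)%N & r j != 0) /\
    forall q, U q -> \sum_(j < n.+1) (r j).[linform K L q] * G j q = 0.
Proof.
move=> KL0 pF0 F0U F0q0; have [P PE] := pfun_linform_coord KL0 pF0.
have P0 : P != 0 by apply: contra_neq F0q0 => P0; rewrite PE P0 !horner0.
(* This bound is fixed before [G], because the family used later, a^j b^(n-j), itself depends on
   n. *)
exists (size P).-1 => G pG.
have [g gE] := choice (fun j => pfun_linform_coord KL0 (pG j)).
(* Remainders modulo [P] have size at most n, so n + 1 of them are dependent over polynomials in
   [linform K L]. The powers of the leading coefficient due to pseudo-division go into the
   coefficients. *)
have [|c c0 cE] := @poly_dependent _ (size P).-1 (fun j => g j %% P).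
  move=> j; rewrite -ltnS prednK ?size_poly_gt0 //.
  exact: Pdiv.Idomain.ltn_modpN0.
exists (fun j => c 0 (inord j) * lead_coef P ^+ scalp (g j) P).
split.
  have /rV0Pn[j cj] := c0; exists j => //.
  by rewrite inord_val mulf_neq0 // Pdiv.Idomain.lc_expn_scalp_neq0.
move=> q Uq; pose ev (f : {poly {poly R[i]}}) := f.[(linform (- L) K q)%:P].[linform K L q].
have evP : ev P = 0 by rewrite /ev -PE F0U.
transitivity (ev (\sum_(j < (size P).-1.+1) c 0 j *: (g j %% P)));
  last by rewrite cE /ev !horner0.
rewrite /ev horner_sum horner_sum; apply: eq_bigr => j _.
have /(congr1 ev) := Pdiv.Idomain.divp_eq (g j) P.
rewrite /ev hornerZ hornerD !hornerM hornerD hornerM -[P.[_].[_]]/(ev P) evP mulr0 add0r.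
by rewrite hornerZ hornerM => <-; rewrite inord_val gE mulrA.
Qed.

Section AxLindemann.
Variables (R : realType) (P : {poly {poly R}}) (U : set (R * R)).
Hypothesis U_reg : forall q, U q -> eval2 P^`() q != 0.
Hypothesis U_arc : forall q, U q -> exists f : R -> R, [/\ f q.1 = q.2,
    is_derive q.1 1 f (- eval2 (pderiv P) q / eval2 P^`() q) &
    \forall x \near q.1, U (x, f x)].
Implicit Types (F G : R * R -> R[i]).
Local Notation along := (along P U).

Let zero F := forall q, U q -> F q = 0.

Hypothesis U_prime : forall F G, pfun F -> pfun G ->
  zero (fun q => F q * G q) -> zero F \/ zero G.
Hypothesis U_not_line : forall (K L : R) (r : {poly R[i]}), (K, L) != (0, 0) ->
  zero (fun q => r.[linform K L q]) -> r = 0.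

(** The field D = P_Y d/dX - P_X d/dY applied to [linform K L]. *)
Definition tangent (K L : R) (q : R * R) : R[i] :=
  ((- (L * eval2 (pderiv P) q)) +i* (K * eval2 P^`() q))%C.

Hypothesis tangent_neq0 : forall K L : R, (K, L) != (0, 0) -> ~ zero (tangent K L).
Hypothesis U_curve : exists F q0, [/\ pfun F, zero F & F q0 != 0].

Lemma pfun_tangent_linform K L : pfun (tangent K L).
Proof.
have -> : tangent K L = fun q =>
    (- L)%:C%C * (eval2 (pderiv P) q)%:C%C + (0 +i* K)%C * (eval2 P^`() q)%:C%C.
  apply/funext => q; apply/eqP; rewrite eq_complex /=.
  by apply/andP; split; apply/eqP; ring.
by constructor; constructor; try exact: pfun_eval2; constructor.
Qed.

Section NoRelation.
(* The hypotheses say that [a / b] is, up to a constant, the exponential of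
   [- linform K L] along the curve. *)
Variables (K L : R) (a b a' b' : R * R -> R[i]).
Hypotheses (KL0 : (K, L) != (0, 0)) (pa : pfun a) (pb : pfun b).
Hypotheses (aa : along a a') (bb : along b b') (a0 : ~ zero a) (b0 : ~ zero b).
Hypothesis ab : zero (fun q => b q * a' q - a q * b' q + a q * b q * tangent K L q).

Variable n : nat.
Let e (j : nat) q := a q ^+ j * b q ^+ (n - j).
Let rel (r : nat -> {poly R[i]}) :=
  zero (fun q => \sum_(j < n.+1) (r j).[linform K L q] * e j q).

Let pe j : pfun (e j).
Proof. by constructor; exact: pfunX. Qed.

(** With h = [linform K L], the hypothesis [ab] reads D(a) / a = D(b) / b - D(h), so D(e_j) = e_j (n
    D(b) / b - j D(h)), here multiplied by a b. The term in n is the same for all j. *)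
Let e_along j : (j < n.+1)%N -> exists2 e', along (e j) e' &
  forall q, U q -> a q * b q * e' q =
    e j q * (n%:R * (a q * b' q) - j%:R * (a q * b q * tangent K L q)).
Proof.
move=> jn.
have H := alongM (along_exp j aa) (along_exp (n - j) bb).
apply: (ex_intro2 _ _ _ H) => q Uq; have := ab Uq; rewrite /e.
have -> : n%:R = j%:R + (n - j)%:R :> R[i] by rewrite -natrD subnKC.
move: (a q) (b q) (a' q) (b' q) (tangent K L q) => x y x' y' t xy.
have expE (z : R[i]) k : z * (z ^+ k.-1 *+ k) = k%:R * z ^+ k.
  by case: k => [|k]; rewrite ?mulr0n ?mulr0 ?mul0r //= mulrnAr -exprS mulr_natl.
have -> : x * y * (x ^+ j * (y ^+ (n - j).-1 *+ (n - j) * y') +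
    x ^+ j.-1 *+ j * x' * y ^+ (n - j)) =
    x ^+ j * x * y' * (y * (y ^+ (n - j).-1 *+ (n - j))) +
    y ^+ (n - j) * y * x' * (x * (x ^+ j.-1 *+ j)) by ring.
rewrite !expE; move: (x ^+ j) (y ^+ (n - j)) => u v.
have -> : x * y * t = x * y' - y * x' by rewrite -[RHS]addr0 -xy; ring.
by ring.
Qed.

(** Up to a multiple of the relation, a b times its derivative is a b D(h) times the sum with
    coefficients r_j' - j r_j. Adding c a b D(h) times the relation changes nothing, and [U_prime]
    cancels a b D(h). *)
Let rel_deriv r (c : R[i]) : rel r ->
  rel (fun j => (r j)^`() + (c - j%:R) *: r j).
Proof.
move=> rel_r.
have /choice[e' e'E] : forall j, exists e', (j < n.+1)%N -> along (e j) e' /\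
  forall q, U q -> a q * b q * e' q =
    e j q * (n%:R * (a q * b' q) - j%:R * (a q * b q * tangent K L q)).
  move=> j; case: (ltnP j n.+1) => [/e_along[e' ? ?]|_]; last by exists (fun=> 0).
  by exists e'.
have sum_along : along (fun q => \sum_(j < n.+1) (r j).[linform K L q] * e j q)
    (fun q => \sum_(j < n.+1) ((r j).[linform K L q] * e' j q +
       (r j)^`().[linform K L q] * tangent K L q * e j q)).
  apply: along_sum => j; apply: alongM; last by case: (e'E j (ltn_ord j)).
  by apply: along_horner; exact: along_linform.
have S0 := along_zero U_reg U_arc sum_along rel_r.
have : zero (fun q => (a q * b q * tangent K L q) *
    \sum_(j < n.+1) ((r j)^`() + (c - j%:R) *: r j).[linform K L q] * e j q).
  move=> q Uq; have := S0 q Uq; have := rel_r q Uq; move=> /= sum0 sum'0.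
  transitivity (a q * b q * (\sum_(j < n.+1) ((r j).[linform K L q] * e' j q +
      (r j)^`().[linform K L q] * tangent K L q * e j q)) +
      (c * (a q * b q * tangent K L q) - n%:R * (a q * b' q)) *
      \sum_(j < n.+1) (r j).[linform K L q] * e j q); last first.
    by rewrite sum'0 sum0 !mulr0 addr0.
  rewrite !mulr_sumr -big_split /=; apply: eq_bigr => j _.
  have := (e'E j (ltn_ord j)).2 q Uq; rewrite hornerD hornerZ.
  move: (r j).[_] (r j)^`().[_] (e' j q) (e j q) (a q) (b q) (b' q) (tangent K L q).
  move=> s s' d d0 x y y' t xyd.
  rewrite [x * y * (_ + _)]mulrDr [x * y * (s * d)]mulrCA xyd.
  by ring.
have pab : pfun (fun q => a q * b q) by constructor.
have psum : pfun (fun q => \sum_(j < n.+1)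
    ((r j)^`() + (c - j%:R) *: r j).[linform K L q] * e j q).
  by apply: pfun_sum => j; constructor=> //; apply: pfun_horner; exact: pfun_linform.
case/U_prime => //; first by constructor=> //; exact: pfun_tangent_linform.
case/U_prime => //; first exact: pfun_tangent_linform.
- by case/U_prime.
- by move/(tangent_neq0 KL0).
Qed.

(** Descent on the total size of the coefficients. If [r j0] and [r j1] are nonzero, [rel_deriv]
    with c = j1 shortens [r j1], lengthens no coefficient and keeps the size of [r j0], against the
    induction hypothesis. A single nonzero coefficient is excluded by [U_prime] and [U_not_line]. *)
Lemma exp_transcendental r : rel r -> forall j, (j < n.+1)%N -> r j = 0.
Proof.
have [m] := ubnP (\sum_(j < n.+1) size (r j)).
elim: m r => // m IH r; rewrite ltnS => r_m rel_r j0 j0n.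
apply/eqP; rewrite -[_ == _]negbK; apply/negP => rj0.
pose i0 := Ordinal j0n.
have [/existsP[j1 /andP[j10 rj1]]|] :=
    boolP [exists j : 'I_n.+1, (j != i0) && (r j != 0)]; last first.
  rewrite negb_exists => /forallP r0.
  have : zero (fun q => (r j0).[linform K L q] * e j0 q).
    move=> q Uq; have := rel_r q Uq; rewrite (bigD1 i0) //= big1 ?addr0 // => j j0'.
    by have := r0 j; rewrite j0' /= negbK => /eqP ->; rewrite horner0 mul0r.
  have pX c k : pfun c -> ~ zero c -> ~ zero (fun q => c q ^+ k).
    move=> pc c0; elim: k => [|k IHk].
      move=> c1; apply: c0 => q /c1/eqP; by rewrite expr0 oner_eq0.
    under eq_fun do rewrite exprS; case/U_prime => //; exact: pfunX.
  case/U_prime => //; first by apply: pfun_horner; exact: pfun_linform.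
    by move/(U_not_line KL0)/eqP; apply/negP.
  case/U_prime; [exact: pfunX|exact: pfunX|exact: pX|exact: pX].
pose r2 j := (r j)^`() + (j1%:R - j%:R) *: r j.
have r2_size j : (size (r2 j) <= size (r j))%N.
  rewrite (leq_trans (size_polyD _ _)) // geq_max size_scale_leq andbT.
  by have [->|/lt_size_deriv/ltnW//] := eqVneq (r j) 0; rewrite deriv0.
have r2_j1 : (size (r2 j1) < size (r j1))%N.
  by rewrite /r2 subrr scale0r addr0 lt_size_deriv.
have : r2 j0 = 0.
  apply: IH => //; last exact: rel_deriv.
  apply: leq_trans r_m; rewrite (bigD1 j1) //= [in leqRHS](bigD1 j1) //=.
  by rewrite -addSn leq_add // leq_sum.
have j10' : (j1%:R - j0%:R : R[i]) != 0 by rewrite subr_eq0 eqr_nat.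
move=> /(congr1 (fun p : {poly R[i]} => size p)); rewrite size_poly0 /r2 addrC size_polyDl.
  by rewrite size_scale // => /eqP; rewrite size_poly_eq0 (negPf rj0).
by rewrite size_scale // lt_size_deriv.
Qed.

End NoRelation.

(** By [pfun_dependent] the monomials a^j b^(n-j) satisfy a nontrivial relation over polynomials in
    [linform K L], which [exp_transcendental] forbids. *)
Lemma exp_quotient_transcendental K L a b a' b' : (K, L) != (0, 0) ->
  pfun a -> pfun b -> along a a' -> along b b' -> ~ zero a -> ~ zero b ->
  ~ zero (fun q => b q * a' q - a q * b' q + a q * b q * tangent K L q).
Proof.
move=> KL0 pa pb aa bb a0 b0 ab; have [F [q0 [pF F0 Fq0]]] := U_curve.
have [n /(_ (fun j q => a q ^+ j * b q ^+ (n - j)))[]] :=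
  pfun_dependent KL0 pF F0 Fq0.
  by move=> j; constructor; exact: pfunX.
move=> r [[j jn rj] rel_r].
by move: rj; rewrite (exp_transcendental KL0 pa pb aa bb a0 b0 ab rel_r jn) eqxx.
Qed.

(** Induction on the number of terms: the first exponential is eliminated between the relation and
    its derivative, leaving a shorter relation. *)
Lemma linear_independent_exp (T : eqType) (K L : T -> R) (s : seq T)
    (a : T -> R * R -> R[i]) :
  uniq s -> {in s &, injective (fun i => (K i, L i))} ->
  (forall i, pfun (a i)) ->
  zero (fun q => \sum_(i <- s) a i q * cexp (linform (K i) (L i) q)) ->
  forall i, i \in s -> zero (a i).
Proof.
elim: s a => [//|i0 s IH] a /= /andP[i0s us] KL_inj pa.
under eq_fun do rewrite big_cons.
set b := a i0; set e := fun i q => cexp (linform (K i) (L i) q).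
move=> sum0.
have s_inj : {in s &, injective (fun i => (K i, L i))}.
  by move=> i j si sj; apply: KL_inj; rewrite inE ?si ?sj orbT.
have [b0|b0] := pselect (zero b).
  have /IH : zero (fun q => \sum_(i <- s) a i q * e i q).
    by move=> q Uq; have := sum0 q Uq; rewrite b0 // mul0r add0r.
  move=> /(_ us s_inj pa) H i; rewrite inE => /predU1P[->//|]; exact: H.
have /choice[a' /all_and2[pa' aa']] : forall i, exists a', pfun a' /\ along (a i) a'.
  by move=> i; have [a' ? ?] := along_pfun U_reg (pa i); exists a'.
(* The coefficient of [e i] in b D(S) - (D(b) + b D(h)) S, where S is the given sum and h the linear
   form of [i0]; that of [e i0] is zero. *)
pose c i q := b q * (a' i q + a i q * tangent (K i) (L i) q) -
  a i q * (a' i0 q + b q * tangent (K i0) (L i0) q).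
have e_along i : along (e i) (fun q => e i q * tangent (K i) (L i) q).
  by apply: along_cexp; exact: along_linform.
have term_along i : along (fun q => a i q * e i q) (fun q =>
    a i q * (e i q * tangent (K i) (L i) q) + a' i q * e i q).
  exact: alongM.
have sum_along := alongD (term_along i0) (along_sum s term_along).
have sum'0 := along_zero U_reg U_arc sum_along sum0.
have c0 i : i \in s -> zero (c i).
  apply: IH => //.
    have pt K1 L1 := pfun_tangent_linform K1 L1.
    have pD j : pfun (fun q => a' j q + a j q * tangent (K j) (L j) q).
      by apply: pfunD => //; exact: pfunM.
    by move=> j; apply: pfunB; apply: pfunM (pa _) (pD _).
  move=> q Uq; transitivity
    (b q * (a i0 q * (e i0 q * tangent (K i0) (L i0) q) + a' i0 q * e i0 q +
       \sum_(i <- s) (a i q * (e i q * tangent (K i) (L i) q) + a' i q * e i q)) -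
     (a' i0 q + b q * tangent (K i0) (L i0) q) *
       (b q * e i0 q + \sum_(i <- s) a i q * e i q)); last first.
    by rewrite sum'0 // sum0 // !mulr0 subrr.
  rewrite !mulrDr !mulr_sumr opprD addrACA -sumrB -[LHS]add0r; congr (_ + _).
    by rewrite /b; ring.
  by apply: eq_bigr => j _; rewrite /c -/(e j q); ring.
have a0 i : i \in s -> zero (a i).
  move=> si; apply: contrapT => ai0.
  have KL0 : (K i - K i0, L i - L i0) != (0, 0).
    apply/negP => /eqP[/eqP Ki /eqP Li]; move: i0s; apply/negP; rewrite negbK.
    suff <- : i = i0 by [].
    apply: KL_inj; rewrite ?inE ?si ?eqxx ?orbT //; congr (_, _).
      by apply/eqP; rewrite -subr_eq0.
    by apply/eqP; rewrite -subr_eq0.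
  (* The vanishing of [c i] is the excluded relation for the quotient of [a i] by [a i0] and the
     difference of their linear forms. *)
  apply: (exp_quotient_transcendental KL0 (pa i) (pa i0) (aa' i) (aa' i0)) => //.
  move=> q Uq; rewrite -(c0 i si q Uq) /c -/b.
  have -> : tangent (K i - K i0) (L i - L i0) q =
      tangent (K i) (L i) q - tangent (K i0) (L i0) q.
    apply/eqP; rewrite eq_complex /tangent /=.
    by apply/andP; split; apply/eqP; ring.
  by ring.
move=> i; rewrite inE => /predU1P[-> q Uq|]; last exact: a0.
have := sum0 q Uq; rewrite big_seq big1 => [|j sj]; last by rewrite a0 // mul0r.
by rewrite addr0 => /eqP; rewrite mulf_eq0 (negPf (cexp_neq0 _)) orbF => /eqP.
Qed.

End AxLindemann.

(** * Weakly bialgebraic sets *)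

Lemma poly_inj_roots_eq0 (A : idomainType) (g : nat -> A) (p : {poly A}) :
  injective g -> (forall i, p.[g i] = 0) -> p = 0.
Proof.
move=> g_inj pg; apply/eqP; apply: contraT => p0.
have := max_poly_roots (rs := [seq g i | i <- iota 0 (size p)]) p0.
rewrite size_map size_iota ltnn (map_inj_uniq g_inj) iota_uniq; apply => //.
by apply/allP => _ /mapP[i _ ->]; apply/rootP.
Qed.

Lemma eval2_eq0 (R : realType) (p : {poly {poly R}}) :
  (forall q, eval2 p q = 0) -> p = 0.
Proof.
move=> p0; apply: (@poly_inj_roots_eq0 _ (fun i => i%:R%:P)).
  by move=> i j /polyC_inj/eqP; rewrite eqr_nat => /eqP.
move=> i; apply: (@poly_inj_roots_eq0 _ (fun i => i%:R)).
  by move=> j k /eqP; rewrite eqr_nat => /eqP.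
by move=> j; exact: (p0 (j%:R, i%:R)).
Qed.

Lemma deriv_eq0_size (R : realType) (p : {poly R}) : p^`() = 0 -> (size p <= 1)%N.
Proof.
move=> p'0; apply/leq_sizeP => -[//|i] _.
by have /eqP := coef_deriv p i; rewrite p'0 coef0 eq_sym mulrn_eq0 => /eqP.
Qed.

Lemma pderiv_eq0_eval2 (R : realType) (p : {poly {poly R}}) : pderiv p = 0 ->
  exists r : {poly R}, forall q, eval2 p q = r.[q.2].
Proof.
move=> p'0; exists (map_poly (coefp 0) p) => -[x y]; rewrite eval2_map /=.
rewrite -[map_poly _ p]/(map_poly (horner_eval x) p); congr (_.[_]).
apply/polyP => i; rewrite coef_map coef_map_id0 /coefp ?coef0 //=.
have /size1_polyC -> : (size (p`_i)%R <= 1)%N.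
  by apply: deriv_eq0_size; rewrite -coef_map -/(pderiv p) p'0 coef0.
by rewrite /horner_eval hornerC coefC.
Qed.

Lemma cexpMn (R : realType) (z : R[i]) n : cexp (z *+ n) = cexp z ^+ n.
Proof.
elim: n => [|n IH]; first by rewrite mulr0n expr0 cexp0.
by rewrite mulrS exprS cexp_add IH.
Qed.

Lemma linformE (R : realType) (K L : R) q m n :
  linform K L q *+ m + linform (- K) L q *+ n =
  linform (K * (m%:R - n%:R)) (L * (m%:R + n%:R)) q.
Proof.
have Mn (a b : R) k : (a +i* b)%C *+ k = ((a *+ k) +i* (b *+ k))%C.
  by elim: k => [//|k IH]; rewrite !mulrS IH.
rewrite /linform !Mn; apply/eqP; rewrite eq_complex /=.
by apply/andP; split; apply/eqP; rewrite -(mulr_natr _ m) -(mulr_natr _ n); ring.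
Qed.

(** With w = exp(2 pi i (x + i y)), the left-hand sides are i times the conjugate of w and -i times
    w: in these coordinates each component of [E] is a constant times one exponential. *)
Lemma linform_E (R : realType) (q : R * R) :
  linform 1 1 (E q) = 'i%C * cexp (linform (- (2 * pi)) (- (2 * pi)) q) /\
  linform (- 1) 1 (E q) = - 'i%C * cexp (linform (2 * pi) (- (2 * pi)) q).
Proof.
rewrite /E /cexp /linform /= !mul0r sub0r add0r !mulNr cosN sinN.
by split; apply/eqP; rewrite eq_complex /=; apply/andP; split; apply/eqP; ring.
Qed.

Section Bialgebraic.
Variables (R : realType) (V0 : A2_subvariety R).
Let V := A2_points V0.
Hypothesis V_irr : ~ (exists V1 V2 : A2_subvariety R,
  [/\ V = A2_points V1 `|` A2_points V2,
      A2_points V1 `<` V & A2_points V2 `<` V]).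
Hypothesis V_neqT : V <> setT.
Hypothesis V_neq0 : V !=set0.
Hypothesis V_not_singleton : ~ (exists a, V = [set a]).
Hypothesis V_not_line :
  ~ ((exists t, V = horizontal_line t) \/ (exists t, V = vertical_line t)).

Let vanish (p : {poly {poly R}}) := forall q, V q -> eval2 p q = 0.

Lemma ideal_vanish p : A2_ideal V0 p -> vanish p.
Proof. by move=> Ip q; exact. Qed.

Lemma vanish_nonzero : exists p q0, vanish p /\ eval2 p q0 != 0.
Proof.
have [q0 Vq0] : exists q0, ~ V q0.
  by apply/existsNP => VT; apply: V_neqT; apply/seteqP; split.
move/existsNP: Vq0 => [p /not_implyP[Ip /eqP p0]].
by exists p, q0; split=> //; exact: ideal_vanish.
Qed.

Lemma vanish_minimal : exists P : {poly {poly R}}, [/\ P != 0, vanish P &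
  forall p, vanish p -> (size p < size P)%N -> p = 0].
Proof.
pose Q k := `[< exists p, [/\ p != 0, vanish p & size p = k] >].
have exQ : exists k, Q k.
  have [p [q0 [Vp pq0]]] := vanish_nonzero.
  exists (size p); apply/asboolP; exists p; split=> //.
  by apply: contra_neq pq0 => ->; rewrite /eval2 !horner0.
case: (ex_minnP exQ) => k /asboolP[P [P0 VP <-]] kmin.
exists P; split=> // p Vp pP; apply/eqP; apply: contraTT pP => p0.
by rewrite -leqNgt; apply: kmin; apply/asboolP; exists p.
Qed.

Section WithMinimal.
Variable P : {poly {poly R}}.
Hypotheses (P0 : P != 0) (VP : vanish P).
Hypothesis P_min : forall p, vanish p -> (size p < size P)%N -> p = 0.

(** At such a point P_Y <> 0 gives an arc of zeros of [P], and the nonvanishing leading coefficient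
    ensures that the zeros near the point lie in [V]. *)
Let regular : set (R * R) :=
  [set q | [/\ V q, (lead_coef P).[q.1] != 0 & eval2 P^`() q != 0]].

Lemma vanish_polyC (c : {poly R}) : vanish c%:P -> c = 0.
Proof.
move=> Vc; apply/eqP; apply: contraT; rewrite -(map_poly_eq0 (real_complex R)) => c0.
exfalso; apply: V_not_line; right.
have [|z zE] := vanish_algebraic_const V_irr (@pfun_x R) c0 V_neq0.
  by move=> q Vq; rewrite horner_map -[c.[_]]eval2P Vc.
exists (complex.Re z); apply: vanish_vertical => // q Vq.
by rewrite -(zE _ Vq).
Qed.

(** The factor [H] vanishes at the points of [V] that are not regular, so H F G vanishes on all of
    [V] and [vanish_prime] applies. *)
Let regular_prime F G : pfun F -> pfun G ->
  (forall q, regular q -> F q * G q = 0) ->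
  (forall q, regular q -> F q = 0) \/ (forall q, regular q -> G q = 0).
Proof.
move=> pF pG FG0.
pose H q := ((lead_coef P).[q.1])%:C%C * (eval2 P^`() q)%:C%C.
have pH : pfun H by apply: pfunM; [exact: pfun_horner_x|exact: pfun_eval2].
have [q Vq||] := vanish_prime V_irr (pfunM pH pF) pG.
- apply/eqP; rewrite /H -!mulrA; have [->|l0] := eqVneq (lead_coef P).[q.1] 0.
    by rewrite mul0r.
  have [->|y0] := eqVneq (eval2 P^`() q) 0; first by rewrite mul0r mulr0.
  by rewrite FG0 ?mulr0.
- move=> HF; left=> q [Vq l0 y0]; have /eqP := HF _ Vq.
  by rewrite /H !mulf_eq0 !fmorph_eq0 (negPf l0) (negPf y0) => /eqP.
- by move=> HG; right=> q [Vq _ _]; exact: HG.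
Qed.

Let size_P_gt1 : (1 < size P)%N.
Proof.
rewrite ltnNge; apply/negP => /size1_polyC PC.
by move: P0 VP; rewrite PC => + /vanish_polyC c0; rewrite c0 eqxx.
Qed.

Let derivP_neq0 : P^`() != 0.
Proof.
apply/eqP => P'0; have := size_P_gt1; rewrite ltnNge => /negP; apply.
apply/leq_sizeP => -[//|i] _.
have /eqP := coef_deriv P i; rewrite P'0 coef0 eq_sym -mulr_natr mulf_eq0.
by rewrite -polyC_natr polyC_eq0 pnatr_eq0 orbF => /eqP.
Qed.

(** The two factors defining [regular] can be cancelled, as neither vanishes on all of [V]: the
    leading coefficient by [vanish_polyC], P_Y by minimality of [P]. *)
Let regular_dense F : pfun F -> (forall q, regular q -> F q = 0) ->
  forall q, V q -> F q = 0.
Proof.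
move=> pF F0.
have pl : pfun (fun q => ((lead_coef P).[q.1])%:C%C) by exact: pfun_horner_x.
have py : pfun (fun q => (eval2 P^`() q)%:C%C) by exact: pfun_eval2.
have [q Vq| |//] := vanish_prime V_irr (pfunM pl py) pF.
  apply/eqP; rewrite -!mulrA; have [->|l0] := eqVneq (lead_coef P).[q.1] 0.
    by rewrite mul0r.
  have [->|y0] := eqVneq (eval2 P^`() q) 0; first by rewrite mul0r mulr0.
  by rewrite F0 ?mulr0.
case/(vanish_prime V_irr pl py) => H; exfalso.
  have /vanish_polyC : vanish (lead_coef P)%:P.
    by move=> q Vq; apply: (fmorph_inj (real_complex R)); rewrite eval2P rmorph0 /= H.
  by move/eqP; rewrite lead_coef_eq0 (negPf P0).
have /P_min : vanish P^`().
  by move=> q Vq; apply: (fmorph_inj (real_complex R)); rewrite rmorph0 /= H.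
by move=> /(_ (lt_size_deriv P0))/eqP; rewrite (negPf derivP_neq0).
Qed.

Let regular_neq0 : exists q, regular q.
Proof.
apply: contrapT => /forallNP U0; have [q Vq] := V_neq0.
have /eqP := regular_dense (pfun_cst 1) (fun q Uq => False_ind _ (U0 q Uq)) Vq.
by rewrite oner_eq0.
Qed.

Let regular_reg q : regular q -> eval2 P^`() q != 0. Proof. by case. Qed.

(** Dividing a polynomial of the ideal by [P] leaves a remainder that vanishes on [V] and is zero by
    minimality, so a power of the leading coefficient times the polynomial is a multiple of [P]. *)
Let zero_of_minimal q : (lead_coef P).[q.1] != 0 -> eval2 P q = 0 -> V q.
Proof.
move=> l0 Pq p Ip.
have E := Pdiv.Idomain.divp_eq p P.
have mod_vanish : vanish (p %% P).
  move=> q' Vq'; have /(congr1 (@eval2 R ^~ q')) := E.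
  rewrite -mul_polyC eval2D !eval2M VP // mulr0 add0r => <-.
  by rewrite (ideal_vanish Ip Vq') mulr0.
have mod0 := P_min mod_vanish (Pdiv.Idomain.ltn_modpN0 _ P0).
have /(congr1 (@eval2 R ^~ q)) := E.
rewrite mod0 addr0 -mul_polyC !eval2M Pq mulr0 eval2P horner_exp => /eqP.
by rewrite mulf_eq0 expf_eq0 (negPf l0) andbF => /eqP.
Qed.

Let regular_arc q : regular q -> exists f : R -> R, [/\ f q.1 = q.2,
    is_derive q.1 1 f (- eval2 (pderiv P) q / eval2 P^`() q) &
    \forall x \near q.1, regular (x, f x)].
Proof.
case: q => x0 y0 [Vq l0 Py0].
have [f [fx0 fd fP]] := implicit_function (VP Vq) Py0.
exists f; split=> //.
have fc : {for x0, continuous f}.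
  by apply: differentiable_continuous; apply/derivable1_diffP; case: fd.
have lc : (lead_coef P).[x] @[x --> x0] --> (lead_coef P).[x0].
  exact: continuous_horner.
have yc : eval2 P^`() (x, f x) @[x --> x0] --> eval2 P^`() (x0, f x0).
  exact: continuous_eval2.
have l_near : \forall x \near x0, (lead_coef P).[x] != 0 by exact: cvgr_neq0 lc l0.
have y_near : \forall x \near x0, eval2 P^`() (x, f x) != 0.
  by apply: (cvgr_neq0 _ yc); rewrite fx0.
near=> x; have Px : eval2 P (x, f x) = 0 by near: x.
have lx : (lead_coef P).[x] != 0 by near: x.
have yx : eval2 P^`() (x, f x) != 0 by near: x.
by split=> //; exact: zero_of_minimal.
Unshelve. all: by end_near. Qed.

Let regular_not_line (K L : R) (r : {poly R[i]}) : (K, L) != (0, 0) ->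
  (forall q, regular q -> r.[linform K L q] = 0) -> r = 0.
Proof.
move=> KL0 rU; apply/eqP; apply: contraT => r0; exfalso; apply: V_not_line.
apply: (vanish_linform_line V_irr V_neq0 V_not_singleton KL0 r0).
by apply: regular_dense => //; apply: pfun_horner; exact: pfun_linform.
Qed.

(** If P_X vanished on [V], then D would be P_Y d/dX there and d/dX would preserve the polynomials
    vanishing on [V]. Iterating it would give a nonzero one in Y alone, making [V] a horizontal
    line. *)
Let pderivP_not_vanish : ~ vanish (pderiv P).
Proof.
move=> VPx.
have vanish_pderiv p : vanish p -> vanish (pderiv p).
  move=> Vp q Vq; apply: (fmorph_inj (real_complex R)); rewrite rmorph0.
  apply: (regular_dense (pfun_eval2 (pderiv p)) _ Vq) => {Vq} {}q Uq.
  have pU : forall q, regular q -> (eval2 p q)%:C%C = 0.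
    by move=> q' [Vq' _ _]; rewrite Vp.
  have := along_zero regular_reg regular_arc (along_eval2 regular_reg p) pU Uq.
  have [Vq _ y0] := Uq; rewrite /= VPx // mul0r subr0 rmorphM => /eqP.
  by rewrite mulf_eq0 fmorph_eq0 (negPf y0) => /eqP.
have [m mP] : exists m, forall i, (size (P`_i)%R <= m)%N.
  exists (\max_(i < size P) size (P`_i)%R) => i.
  have [iP|iP] := ltnP i (size P); last by rewrite nth_default // size_poly0.
  exact: (leq_bigmax (Ordinal iP)).
have ex_pderiv0 k : forall p, p != 0 -> vanish p ->
    (forall i, (size (p`_i)%R <= k)%N) ->
    exists p, [/\ p != 0, vanish p & pderiv p = 0].
  elim: k => [|k IH] p p0 Vp pk.
    exfalso; move/eqP: p0; apply; apply/polyP => i; rewrite coef0.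
    by apply/eqP; rewrite -size_poly_leq0.
  have [p'0|p'0] := eqVneq (pderiv p) 0; first by exists p.
  apply: (IH _ p'0); first exact: vanish_pderiv.
  move=> i; rewrite coef_map /=; have [->|pi0] := eqVneq (p`_i) 0.
    by rewrite deriv0 size_poly0.
  by rewrite -ltnS (leq_trans (lt_size_deriv pi0)).
have [p [p0 Vp p'0]] := ex_pderiv0 m P P0 VP mP.
have [r rE] := pderiv_eq0_eval2 p'0.
have r0 : map_poly (real_complex R) r != 0.
  rewrite map_poly_eq0; apply: contra_neq p0 => r0; apply: eval2_eq0 => q.
  by rewrite rE r0 horner0.
apply: V_not_line; left.
have [|z zE] := vanish_algebraic_const V_irr (@pfun_y R) r0 V_neq0.
  by move=> q Vq; rewrite horner_map -rE Vp.
exists (complex.Re z); apply: vanish_horizontal => // q Vq.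
by rewrite -(zE _ Vq).
Qed.

(** The imaginary part K P_Y forces K = 0; then the real part forces P_X to vanish on [V], against
    [pderivP_not_vanish]. *)
Let regular_tangent (K L : R) : (K, L) != (0, 0) ->
  ~ (forall q, regular q -> tangent P K L q = 0).
Proof.
move=> KL0 t0; have [q0 Uq0] := regular_neq0.
have K0 : K = 0.
  have /eqP := t0 _ Uq0; rewrite eq_complex /= => /andP[_].
  by rewrite mulf_eq0 (negPf (regular_reg Uq0)) orbF => /eqP.
have L0 : L != 0 by apply: contra_neq KL0 => L0; rewrite K0 L0.
apply: pderivP_not_vanish => q Vq; apply: (fmorph_inj (real_complex R)).
rewrite rmorph0; apply: (regular_dense (pfun_eval2 (pderiv P)) _ Vq) => {Vq} {}q Uq.
have /eqP := t0 _ Uq; rewrite eq_complex /= oppr_eq0 mulf_eq0 (negPf L0) /=.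
by move=> /andP[/eqP -> _].
Qed.

(** In the coordinates of [linform_E], the equation p(E q) = 0 is a relation with constant
    coefficients between exponentials of distinct linear forms, so all coefficients vanish. *)
Lemma E_not_algebraic (p : {poly {poly R}}) :
  (forall q, V q -> eval2 p (E q) = 0) -> p = 0.
Proof.
move=> pE; have KL0 : (1, 1) != (0, 0) :> R * R by rewrite xpair_eqE oner_eq0.
have [f fE] := pfun_linform_coord KL0 (pfun_eval2 p).
suff f0 : f = 0.
  apply: eval2_eq0 => q; have /eqP := fE q.
  by rewrite f0 !horner0 fmorph_eq0 => /eqP.
pose m := size f; pose n := \max_(j < m) size (f`_j)%R.
pose t : R := 2 * pi.
(* For the index (j, k), j is the exponent of [linform (- 1) 1] and k that of [linform 1 1]; both
   are recovered from j - k and j + k. *)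
pose K (i : 'I_m * 'I_n) : R := t * (i.1%:R - i.2%:R).
pose L (i : 'I_m * 'I_n) : R := - t * (i.1%:R + i.2%:R).
pose a (i : 'I_m * 'I_n) (q : R * R) : R[i] :=
  (f`_i.1)`_i.2 * 'i%C ^+ i.2 * (- 'i%C) ^+ i.1.
have t0 : t != 0 by rewrite mulf_neq0 // ?pnatr_eq0 // gt_eqF // pi_gt0.
have KL_inj : {in index_enum _ &, injective (fun i => (K i, L i))}.
  have Nt0 : - t != 0 by rewrite oppr_eq0.
  move=> [j k] [j' k'] _ _ [] /(mulfI t0) /= jk /(mulfI Nt0) jk'.
  have /eqP : (j%:R : R) = j'%:R by lra.
  have /eqP : (k%:R : R) = k'%:R by lra.
  by rewrite !eqr_nat => /eqP/val_inj -> /eqP/val_inj ->.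
have sum0 q : regular q ->
    \sum_(i <- index_enum _) a i q * cexp (linform (K i) (L i) q) = 0.
  move=> [Vq _ _]; have := fE (E q); rewrite pE // rmorph0 => f0; rewrite [RHS]f0.
  have [-> ->] := linform_E q.
  rewrite (horner_coef f) horner_sum -/m.
  under [RHS]eq_bigr => j _.
    rewrite hornerM horner_exp hornerC (@horner_coef_wide _ n); last first.
      exact: (leq_bigmax j).
    rewrite mulr_suml.
    over.
  rewrite pair_big /=; apply: eq_bigr => -[j k] _ /=.
  rewrite /a /K /L -linformE cexp_add !cexpMn /= !exprMn.
  by rewrite -/t; ring.
have [q0 Uq0] := regular_neq0.
have curve : exists F q1, [/\ pfun F, forall q, regular q -> F q = 0 & F q1 != 0].
  have [p1 [q1 [Vp1 p1q1]]] := vanish_nonzero.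
  exists (fun q => (eval2 p1 q)%:C%C), q1; split; first exact: pfun_eval2.
    by move=> q [Vq _ _]; rewrite Vp1.
  by rewrite fmorph_eq0.
have a0 := linear_independent_exp regular_reg regular_arc regular_prime
  regular_not_line regular_tangent curve (index_enum_uniq _) KL_inj
  (fun i => pfun_cst _) sum0.
have i_neq0 : 'i%C != 0 :> R[i] by rewrite eq_complex /= oner_eq0 andbF.
apply/polyP => j; rewrite coef0.
have [jm|jm] := ltnP j m; last by rewrite nth_default.
apply/polyP => k; rewrite coef0.
have fjn : (size (f`_j)%R <= n)%N by exact: (leq_bigmax (Ordinal jm)).
have [kn|kn] := ltnP k n; last by rewrite nth_default // (leq_trans fjn).
have /eqP := a0 (Ordinal jm, Ordinal kn) (mem_index_enum _) q0 Uq0.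
rewrite /a !mulf_eq0 !expf_eq0 oppr_eq0 (negPf i_neq0) !andbF !orbF.
by move/eqP.
Qed.

End WithMinimal.
End Bialgebraic.

Theorem theorem2p5 (R : realType) (V : set (R * R))
    (V_wba : weakly_bialgebraic V)
    (V_neq0 : V !=set0)
    (V_not_singleton : ~ (exists a : R * R, V = [set a])) :
  (exists t : R, V = horizontal_line t) \/
  (exists t : R, V = vertical_line t).
Proof.
case: V_wba => VT [V0 [W [VE W_proper EV]]] V_irr; subst V.
apply: contrapT => V_not_line.
have [f [If f0]] : exists f, G_ideal W f /\ f != 0.
  apply: contrapT => /forallNP f0; apply: W_proper.
  have [_ I0 _ _ _] := G_idealP W.
  apply/seteqP; split=> [f If|_ ->//] /=.
  by apply/eqP; apply: contrapT => /negP f_neq0; exact: (f0 f).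
have [IG _ _ _ _] := G_idealP W; have [p [n fE]] := IG _ If.
have [P [P0 VP P_min]] := vanish_minimal VT.
(* At points of G the denominator x^2 + y^2 is nonzero, so the vanishing of [f] on E(V) is that of
   its numerator [p]. *)
have p0 : p = 0.
  apply: (E_not_algebraic V_irr VT V_neq0 V_not_singleton V_not_line P0 VP P_min).
  move=> q Vq; have [Eq0 /(_ p n)] := EV _ (imageP (@E R) Vq).
  rewrite -fE => /(_ If)/eqP; rewrite mulf_eq0 invr_eq0 expf_eq0 => /orP[/eqP//|].
  rewrite paddr_eq0 ?sqr_ge0 // !sqrf_eq0 => /andP[_ /andP[/eqP E1 /eqP E2]].
  by exfalso; apply: Eq0; rewrite [E q]surjective_pairing E1 E2.
by move: f0; rewrite fE p0 /G_frac tofrac0 mul0r eqxx.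
Qed.
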